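(* Consider the M/G/$\infty$ polling system with a central point described in the context, operated under the Hamiltonian-tour approach: at the start of each cycle, given the state $n=(n_1,\ldots,n_N)$ of the system ($n_i$ being the number of customers then present at queue $i$), the order in which the group of servers visits the queues during that cycle is chosen, each queue being visited exactly once in the cycle, with the aim of maximising the throughput of the cycle, i.e. the (expected) number of customers that complete service during the cycle given $n$. Then this approach leads to a fixed optimal visiting order, which is independent of the number of customers present at the various queues at the start of the cycle. The throughput of the system for each cycle is maximised if and only if the visiting order is arranged according to an increasing (i.e. non-decreasing) sequence of the index $$\frac{\lambda_i p_i}{\mathbb{E}[E_i]+\mathbb{E}[V_i]+\mathbb{E}[R_i]},\qquad p_i=\mathbb{P}[B_i\leqslant V_i].$$
   Context: The system has $N\geqslant 2$ infinite-buffer queues attended by a single group of infinitely many servers moving together. Customers arrive at queue $i$ according to a Poisson process with rate $\lambda_i$; the arrival processes at different queues are independent. When the servers enter queue $i$ they stay there for a random visit time $V_i$ (positive, with finite mean), whose length does not depend on the queue lengths, and during this time queue $i$ works as an M/G/$\infty$ queue: every customer present when the servers enter starts service at that moment, and every customer arriving during the visit starts service on arrival. Each service time at queue $i$ is distributed as $B_i$. A customer whose service is completed before the end of the visit leaves the system; a customer whose service is not completed by the end of the visit stays in the queue and receives, at the next visit, a new service time drawn from the distribution of $B_i$. Central point: the servers always return to a central point after each completion of a visit to a queue, and depart from it to the next queue to be served. The time from leaving the central point until entering queue $i$ is a random time $E_i$, and the return time to the central point after visiting queue $i$ is a random time $R_i$ (nonnegative, with finite means), so that going from queue $i$ to queue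 $j\neq i$ takes time $R_i+E_j$. All visit times, service times and travel times are mutually independent and independent of the arrival processes; their distributions may depend on $i$. *)

(* Defs.v *)
(* MathComp / MathComp-Analysis. *)
From HB Require Import structures.
From mathcomp Require Export all_boot all_order all_algebra all_fingroup.
From mathcomp Require Export all_classical all_reals all_analysis.

Set Implicit Arguments.
Unset Strict Implicit.
Unset Printing Implicit Defensive.

Import Order.TTheory GRing.Theory Num.Theory.
Import numFieldNormedType.Exports.

Local Open Scope classical_set_scope.
Local Open Scope ring_scope.

Section probability_notions.
Context {R : realType} {d : measure_display} {Omega : measurableType d}.
Variable P : probability Omega R.

(* [T k w] is the epoch of the k-th arrival, counted from 0. *)
Definition arrivals_in (T : nat -> Omega -> R) (s t : R) (w : Omega) : \bar R :=
  (\sum_(0 <= k <oo) ((s < T k w <= t)%R%:R : R)%:E)%E.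

(* The numbers of arrivals in the consecutive intervals ]t_j, t_j+1] are
   independent and Poisson with mean [rate * (t_j+1 - t_j)]; this is written as
   their joint probability mass function.  The t_j increase strictly because
   [poisson_pmf r] is a probability mass function only for [r > 0]. *)
Definition poisson_process (rate : R) (T : nat -> Omega -> R) : Prop :=
  [/\ forall k w, 0 < T k w,
      forall w, nondecreasing_seq (fun k => T k w) &
      forall (t : nat -> R) (m : nat) (c : nat -> nat),
        0 <= t 0%N -> (forall j, t j < t j.+1) ->
        P [set w | forall j, (j < m)%N ->
                     arrivals_in T (t j) (t j.+1) w = ((c j)%:R : R)%:E] =
        (\prod_(j < m) poisson_pmf (rate * (t j.+1 - t j)) (c j))%:E].

(* The sigma-algebra generated by a sequence of real functions. *)
Definition sigma_of (X : nat -> Omega -> R) : set (set Omega) :=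
  <<s \bigcup_k preimage_set_system setT (X k) measurable >>.

(* Finite subfamilies of an arbitrary index type are injections from ['I_m]. *)
Definition mutually_independent (I : Type) (F : I -> set (set Omega)) : Prop :=
  forall (m : nat) (j : 'I_m -> I) (A : 'I_m -> set Omega),
    injective j -> (forall l, F (j l) (A l)) ->
    P (\bigcap_l A l) = (\prod_(l < m) P (A l))%E.

End probability_notions.

Inductive input (N : nat) : Type :=
| VisitTime of 'I_N
| OutboundTime of 'I_N
| ReturnTime of 'I_N
| GenericServiceTime of 'I_N
| CustomerServiceTime of 'I_N & nat
| ArrivalProcess of 'I_N.

(* The random inputs of one cycle.  Time is measured from the start of the
   cycle, when the servers leave the central point and no service is in
   progress; by the lack of memory of the Poisson processes, the arrivals after
   that time again form Poisson processes, independent of the past.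
   [generic_service_time i] plays the role of B_i and is used only for the law of
   the service times and for p_i.  The customers of queue [i] are numbered by
   [nat] and customer [k] gets the service time [service_time i k]; one service
   time per customer is enough, since every queue is visited exactly once in the
   cycle. *)
Record polling_cycle {R : realType} {d : measure_display}
    {Omega : measurableType d} (P : probability Omega R) (N : nat) : Type :=
  PollingCycle {
    arrival_rate : 'I_N -> R;
    visit_time : 'I_N -> {RV P >-> R};
    outbound_time : 'I_N -> {RV P >-> R};
    return_time : 'I_N -> {RV P >-> R};
    generic_service_time : 'I_N -> {RV P >-> R};
    service_time : 'I_N -> nat -> {RV P >-> R};
    arrival_time : 'I_N -> nat -> {RV P >-> R};
    arrival_rate_gt0 : forall i, 0 < arrival_rate i;
    visit_time_gt0 : forall i w, 0 < visit_time i w;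
    outbound_time_ge0 : forall i w, 0 <= outbound_time i w;
    return_time_ge0 : forall i w, 0 <= return_time i w;
    generic_service_time_ge0 : forall i w, 0 <= generic_service_time i w;
    service_time_ge0 : forall i k w, 0 <= service_time i k w;
    visit_time_integrable : forall i,
      P.-integrable [set: Omega] (EFin \o visit_time i);
    outbound_time_integrable : forall i,
      P.-integrable [set: Omega] (EFin \o outbound_time i);
    return_time_integrable : forall i,
      P.-integrable [set: Omega] (EFin \o return_time i);
    service_time_distributed : forall i k (X : set R), measurable X ->
      distribution P (service_time i k) X =
      distribution P (generic_service_time i) X;
    arrival_time_poisson : forall i,
      poisson_process P (arrival_rate i) (fun k => arrival_time i k);
    inputs_independent : mutually_independent P (fun x : input N =>
      match x with
      | VisitTime i => sigma_of (fun=> visit_time i)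
      | OutboundTime i => sigma_of (fun=> outbound_time i)
      | ReturnTime i => sigma_of (fun=> return_time i)
      | GenericServiceTime i => sigma_of (fun=> generic_service_time i)
      | CustomerServiceTime i k => sigma_of (fun=> service_time i k)
      | ArrivalProcess i => sigma_of (fun k => arrival_time i k)
      end) }.

Section cycle.
Context {R : realType} {d : measure_display} {Omega : measurableType d}.
Context {P : probability Omega R} {N : nat}.
Variable C : polling_cycle P N.

(* A visiting order is a permutation [s]: [s k] is the queue visited in the
   k-th place, so that queue [i] is visited in place [s^-1 i]. *)
Definition visit_start (s : 'S_N) (i : 'I_N) (w : Omega) : R :=
  \sum_(k < N | (k < (s^-1)%g i)%N)
     (outbound_time C (s k) w + visit_time C (s k) w + return_time C (s k) w)
  + outbound_time C i w.

Definition visit_end (s : 'S_N) (i : 'I_N) (w : Omega) : R :=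
  visit_start s i w + visit_time C i w.

(* The first [n i] customers of queue [i] are those present at the start of the
   cycle; the following ones are the later arrivals. *)
Definition arrival_epoch (n : 'I_N -> nat) (i : 'I_N) (k : nat) (w : Omega) : R :=
  if (k < n i)%N then 0 else arrival_time C i (k - n i)%N w.

(* Customer [k] starts service when both the customer and the servers are at
   queue [i]; if the arrival is after the end of the visit, the inequality fails. *)
Definition completes (n : 'I_N -> nat) (s : 'S_N) (i : 'I_N) (k : nat)
    (w : Omega) : bool :=
  Num.max (visit_start s i w) (arrival_epoch n i k w) + service_time C i k w
    <= visit_end s i w.

Definition completions (n : 'I_N -> nat) (s : 'S_N) (w : Omega) : \bar R :=
  (\sum_(i < N) \sum_(0 <= k <oo) ((completes n s i k w)%:R : R)%:E)%E.

Definition throughput (n : 'I_N -> nat) (s : 'S_N) : \bar R :=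
  (\int[P]_w completions n s w)%E.

Definition optimal_order (n : 'I_N -> nat) (s : 'S_N) : Prop :=
  forall s' : 'S_N, (throughput n s' <= throughput n s)%E.

Definition completion_probability (i : 'I_N) : R :=
  fine (P [set w | generic_service_time C i w <= visit_time C i w]).

Definition polling_index (i : 'I_N) : R :=
  arrival_rate C i * completion_probability i /
  (fine 'E_P[outbound_time C i] + fine 'E_P[visit_time C i]
   + fine 'E_P[return_time C i]).

End cycle.

(* Main.v *)
(* The Poisson arrivals are independent of the times that govern the visit to
   queue i, and on average rate * x of them occur before time x.  Let S and V be
   the start and the length of the visit and B the service time.  A customer
   arriving before S + V - B completes service exactly when B <= V.  Since S is
   independent of (V, B), the expected number of completions at queue i is
     n_i p_i + lambda_i p_i E[S] + lambda_i E[(V - B)^+],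
   and only E[S], essentially the sum of the mean tours m_j of the queues
   visited before i, depends on the visiting order.  Maximising the throughput thus
   amounts to maximising the sum of m_j m_i c_i over the pairs (j before i),
   where c_i is the index.  Each unordered pair contributes at most
   m_i m_j max(c_i, c_j), with equality for all pairs exactly when c is
   nondecreasing along the order. *)
From HB Require Import structures.
Require Import Defs.
From mathcomp Require Import measurable_realfun ring.

Set Implicit Arguments.
Unset Strict Implicit.
Unset Printing Implicit Defensive.

Import Order.TTheory GRing.Theory Num.Theory.
Import numFieldNormedType.Exports.

Local Open Scope classical_set_scope.
Local Open Scope ring_scope.

(** * Independence *)

Section independent_systems.
Context {R : realType} {d : measure_display} {Omega : measurableType d}.
Variable P : probability Omega R.

Definition independent_systems (G H : set (set Omega)) : Prop :=
  forall A B, G A -> H B -> (P (A `&` B) = P A * P B)%E.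

Lemma independent_systemsC G H :
  independent_systems G H -> independent_systems H G.
Proof. by move=> GH A B HA GB; rewrite setIC GH// muleC. Qed.

Lemma sigma_algebra_sub_measurable (G : set (set Omega)) :
  G `<=` measurable -> <<s G >> `<=` measurable.
Proof.
move=> Gm; apply: smallest_sub => //.
exact: (@sigma_algebra_measurable _ Omega).
Qed.

(** For fixed [B] in [H], the maps sending [A] to the probability of its intersection with [B] and
    to the product of the probabilities are finite measures. They agree on the pi-system [G], hence
    on the sigma-algebra it generates. *)
Lemma independent_systems_sigmal G H :
  G `<=` measurable -> setI_closed G -> G setT -> H `<=` measurable ->
  independent_systems G H -> independent_systems <<s G >> H.
Proof.
move=> Gm GI GT Hm GH A B GA HB.
have mB := Hm _ HB.
have PB0 : (0 <= fine (P B))%R by rewrite fine_ge0.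
rewrite -[LHS]/(mrestr P mB A) muleC -(fineK (fin_num_measure P B mB)).
rewrite -[RHS]/(mscale (NngNum PB0) P A).
apply: (g_sigma_algebra_measure_unique G Gm (fun=> setT)) => //.
- by rewrite bigcup_const.
- move=> E GE; change (P (E `&` B) = ((fine (P B))%:E * P E)%E).
  rewrite GH// muleC.
  by rewrite (fineK (fin_num_measure P B mB)).
- move=> k; change (P (setT `&` B) < +oo)%E; rewrite setTI.
  by rewrite (le_lt_trans (probability_le1 _ mB))// ltry.
Qed.

Lemma independent_systems_sigma G H :
  G `<=` measurable -> setI_closed G -> G setT ->
  H `<=` measurable -> setI_closed H -> H setT ->
  independent_systems G H -> independent_systems <<s G >> <<s H >>.
Proof.
move=> Gm GI GT Hm HI HT GH.
apply: independent_systems_sigmal => //.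
  exact: sigma_algebra_sub_measurable.
exact/independent_systemsC/independent_systems_sigmal/independent_systemsC.
Qed.

End independent_systems.

(** * Subfamilies of a finite independent family *)

Section subfamilies.
Context {R : realType} {d : measure_display} {Omega : measurableType d}.
Variable P : probability Omega R.
Variables (K : finType) (F : K -> set (set Omega)).
Hypothesis Fm : forall x, F x `<=` measurable.
Hypothesis FI : forall x, setI_closed (F x).
Hypothesis FT : forall x, F x setT.

(** A pi-system generating the joint sigma-algebra of the [F x] with [x] in [D]. Letting [B] range
    over all of [K], trivial outside [D], makes events for [D] and for its complement comparable
    factor by factor. *)
Definition subfamily (D : {set K}) : set (set Omega) :=
  [set A | exists B : K -> set Omega,
     [/\ forall x, F x (B x), forall x, x \notin D -> B x = setT &
         A = \bigcap_x B x]].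

Lemma subfamily_measurable D : subfamily D `<=` measurable.
Proof.
move=> _ [B [FB _ ->]].
apply: fin_bigcap_measurable => // x _; exact: Fm.
Qed.

Lemma subfamilyI D : setI_closed (subfamily D).
Proof.
move=> _ _ [A [FA AT ->]] [B [FB BT ->]].
exists (fun x => A x `&` B x); split; last by rewrite bigcapI.
  by move=> x; exact: FI.
by move=> x xD; rewrite AT// BT// setTI.
Qed.

Lemma subfamilyT D : subfamily D setT.
Proof. by exists (fun=> setT); split => //; rewrite bigcapT. Qed.

Lemma subfamily_mem (D : {set K}) x A : x \in D -> F x A -> subfamily D A.
Proof.
move=> xD FA; exists (fun y => if y == x then A else setT); split.
- by move=> y; case: eqP => [->|].
- by move=> y; case: eqP => // -> /negP.
- apply/seteqP; split => w /=.
    by move=> Aw y _; case: ifP.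
  by move=> /(_ x I); rewrite eqxx.
Qed.

Lemma subfamily_measurable_fun (D : {set K}) x (X : Omega -> R) :
  x \in D -> preimage_set_system setT X measurable `<=` F x ->
  measurable_fun [set: g_sigma_algebraType (subfamily D)] X.
Proof.
move=> xD XF _ A mA; apply: sub_sigma_algebra.
by apply: (subfamily_mem xD); apply: XF; exists A.
Qed.

Hypothesis Find : forall A : K -> set Omega, (forall x, F x (A x)) ->
  P (\bigcap_x A x) = (\prod_x P (A x))%E.

(** When an event for [D] meets one for its complement, each index carries at most one nontrivial
    factor, so the product formula splits; this passes from the pi-systems to the sigma-algebras. *)
Lemma independent_subfamilies D : independent_systems P
  <<s subfamily D >> <<s subfamily (~: D) >>.
Proof.
apply: independent_systems_sigma;
  [exact: subfamily_measurable|exact: subfamilyI|exact: subfamilyT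
  |exact: subfamily_measurable|exact: subfamilyI|exact: subfamilyT|].
move=> _ _ [A [FA AT ->]] [B [FB BT ->]].
rewrite -bigcapI !Find//; last by move=> x; exact: FI.
rewrite -big_split/=; apply: eq_bigr => x _.
have [xD|xD] := boolP (x \in D).
  by rewrite BT ?inE ?xD// setIT probability_setT mule1.
by rewrite AT// setTI probability_setT mul1e.
Qed.

End subfamilies.

(** * Integrals of functions of two independent maps *)

Section decoupling.
Context {R : realType} {d : measure_display} {Omega : measurableType d}.
Variable P : probability Omega R.
Context {d1 d2 : measure_display} {T1 : measurableType d1}
  {T2 : measurableType d2}.

Definition independent_maps (X : Omega -> T1) (Y : Omega -> T2) : Prop :=
  independent_systems P (preimage_set_system setT X measurable)
    (preimage_set_system setT Y measurable).

Lemma sub_independent_maps (G H : set (set Omega)) X Y :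
  independent_systems P <<s G >> <<s H >> ->
  measurable_fun [set: g_sigma_algebraType G] X ->
  measurable_fun [set: g_sigma_algebraType H] Y ->
  independent_maps X Y.
Proof.
move=> GH mX mY _ _ [A mA <-] [B mB <-].
by apply: GH; [exact: mX|exact: mY].
Qed.

Lemma integral_independent (X : Omega -> T1) (Y : Omega -> T2)
    (f : T1 * T2 -> \bar R) :
  measurable_fun setT X -> measurable_fun setT Y -> independent_maps X Y ->
  measurable_fun setT f -> (forall z, 0 <= f z)%E ->
  (\int[P]_w f (X w, Y w) = \int[P]_w \int[P]_v f (X w, Y v))%E.
Proof.
move=> mX mY XY mf f0.
pose X' : {mfun Omega >-> T1} := HB.pack X (isMeasurableFun.Build _ _ _ _ _ mX).
pose Y' : {mfun Omega >-> T2} := HB.pack Y (isMeasurableFun.Build _ _ _ _ _ mY).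
have mZ : measurable_fun setT (fun w => (X w, Y w)).
  exact: measurable_fun_pair.
pose Z : {mfun Omega >-> (T1 * T2)%type} :=
  HB.pack (fun w => (X w, Y w)) (isMeasurableFun.Build _ _ _ _ _ mZ).
rewrite -[LHS]/(\int[P]_w (f \o Z) w)%E -ge0_integral_distribution//.
(* The product measure is determined by rectangles, where independence is exactly the product
   formula; Tonelli's theorem then applies to the joint law. *)
have E : forall A, measurable A ->
    (distribution P X' \x distribution P Y')%E A = distribution P Z A.
  apply: product_measure_unique => A B mA mB.
  rewrite /= /distribution/= /pushforward/=.
  by apply: XY; [exists A => //; rewrite setTI|exists B => //; rewrite setTI].
rewrite (eq_measure_integral (distribution P X' \x distribution P Y')%E);
  last first.
  by move=> A mA _; exact/esym/E.
rewrite fubini_tonelli1//=.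
rewrite ge0_integral_distribution//=.
- apply: eq_integral => w _; rewrite /fubini_F /=.
  rewrite (ge0_integral_distribution (P := P) Y' (f := fun y => f (X w, y)))//.
  exact: measurableT_comp.
- exact: measurable_fun_fubini_tonelli_F.
- by move=> x; apply: integral_ge0 => y _.
Qed.

End decoupling.

(** * Poisson arrivals *)

Section boolean_maps.
Context {R : realType} {d : measure_display} {T : measurableType d}.
Variable b : T -> bool.
Hypothesis mb : measurable_fun setT b.

Lemma measurable_fun_natr : measurable_fun setT (fun w => ((b w)%:R : R)%:E).
Proof.
apply/measurable_EFinP.
have -> : (fun w => (b w)%:R : R) = (fun w => if b w then 1 else 0).
  by apply/funext => w; case: (b w).
exact: measurable_fun_ifT.
Qed.

Lemma measurable_set_bool : measurable [set w | b w].
Proof. by rewrite -[X in measurable X]setTI; exact: (mb measurableT). Qed.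

Lemma integral_natr (P : {measure set T -> \bar R}) :
  (\int[P]_w ((b w)%:R : R)%:E = P [set w | b w])%E.
Proof.
rewrite -[X in P X]setIT -integral_indic//; last exact: measurable_set_bool.
by apply: eq_integral => w _; rewrite indicE mem_setE.
Qed.

End boolean_maps.

Lemma poisson_pmf_sum (R : realType) (r : R) : 0 < r ->
  (\sum_(0 <= c <oo) (poisson_pmf r c)%:E = 1)%E.
Proof.
move=> r0; have := @probability_setT _ _ _ (poisson_prob r 0).
rewrite /= /poisson_prob r0 => <-; rewrite -nneseries_esumT//.
by move=> n; rewrite lee_fin poisson_pmf_ge0.
Qed.

(** The term of index [c.+1] is [r] times the mass at [c]; dropping the zero term and shifting the
    index leaves [r] times the total mass. *)
Lemma poisson_pmf_mean (R : realType) (r : R) : 0 < r ->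
  (\sum_(0 <= c <oo) (c%:R * poisson_pmf r c)%:E = r%:E)%E.
Proof.
move=> r0.
have f0 c : (0 <= (c%:R * poisson_pmf r c)%:E)%E.
  by rewrite lee_fin mulr_ge0// poisson_pmf_ge0.
rewrite nneseries_recl// mul0r add0e -nneseries_addn//.
rewrite -[RHS]mule1 -(poisson_pmf_sum r0) -nneseriesZl; last first.
  by move=> c _; rewrite lee_fin poisson_pmf_ge0.
apply: eq_eseriesr => c _; rewrite -EFinM; congr EFin.
rewrite /poisson_pmf r0 addn1 exprS factS natrM.
have c1 : c.+1%:R != 0 :> R by rewrite pnatr_eq0.
have cf : c`!%:R != 0 :> R by rewrite pnatr_eq0 -lt0n fact_gt0.
set a := c.+1%:R in c1 *; set b := c`!%:R in cf *.
by field; rewrite cf addrC natr1.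
Qed.

Section poisson_arrivals.
Context {R : realType} {d : measure_display} {Omega : measurableType d}.
Variable P : probability Omega R.
Variables (rate : R) (T : nat -> Omega -> R).
Hypothesis rate0 : 0 < rate.
Hypothesis mT : forall k, measurable_fun setT (T k).
Hypothesis PT : poisson_process P rate T.

Let measurable_arrived s t k :
  measurable_fun setT (fun w => (((s < T k w <= t)%R%:R : R)%:E)).
Proof.
apply/measurable_fun_natr/measurable_and; first exact: measurable_fun_ltr.
exact: measurable_fun_ler.
Qed.

Lemma measurable_arrivals_in s t : measurable_fun setT (arrivals_in T s t).
Proof.
by apply: ge0_emeasurable_sum.
Qed.

(** All epochs being positive, the sum is the expected number of arrivals in ]0, x]. Splitting by
    the value of this count reduces it to the Poisson mean. *)
Lemma poisson_expected_arrivals x : 0 <= x ->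
  (\sum_(0 <= k <oo) P [set w | (T k w <= x)%R] = (rate * x)%:E)%E.
Proof.
have [T0 _ PTc] := PT.
rewrite le_eqVlt => /predU1P[<-|x0].
  rewrite mulr0; apply: eseries0 => k _ _.
  rewrite (_ : [set _ | _] = set0) ?measure0// -subset0 => w /=.
  by rewrite leNgt T0.
have rx0 : 0 < rate * x by rewrite mulr_gt0.
have Eint k : P [set w | (T k w <= x)%R] =
    (\int[P]_w ((0 < T k w <= x)%R%:R : R)%:E)%E.
  rewrite integral_natr; last first.
    apply: measurable_and; first exact: measurable_fun_ltr.
    exact: measurable_fun_ler.
  by congr (P _); apply/seteqP; split => w /=; rewrite T0.
under eq_eseriesr do rewrite Eint.
rewrite -integral_nneseries//.
change (\int[P]_w arrivals_in T 0 x w = (rate * x)%:E)%E.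
pose A c := [set w | arrivals_in T 0 x w = ((c%:R : R)%:E)].
have mN := measurable_arrivals_in 0 x.
have mA c : measurable (A c).
  rewrite -[X in measurable X]setTI.
  exact: (mN measurableT [set (c%:R)%:E] (emeasurable_set1 _)).
have PA c : P (A c) = (poisson_pmf (rate * x) c)%:E.
  (* The process is specified on infinite strictly increasing grids; the multiples of [x] form one,
     and only its first interval is counted. *)
  have := PTc (fun j => j%:R * x) 1%N (fun=> c).
  rewrite /= mul0r => /(_ (lexx _)); rewrite big_ord1 /= mul1r mul0r subr0.
  move=> <-; last by move=> j; rewrite ltr_pM2r// ltr_nat.
  congr (P _); apply/seteqP; split => w /=.
    by move=> Aw [|//] _; rewrite mul0r mul1r.
  by move=> /(_ 0%N isT); rewrite mul0r mul1r.
have tA : trivIset setT A.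
  apply/trivIsetP => i j _ _ ij; rewrite -subset0 => w [].
  rewrite /A /= => -> [] /eqP.
  by rewrite eqr_nat (negbTE ij).
(* The count may be infinite, so the [A c] cover the space only up to a null set, because the
   Poisson masses sum to one. *)
have PU : P (~` \bigcup_c A c) = 0%E.
  rewrite probability_setC; last exact: bigcupT_measurable.
  rewrite measure_semi_bigcup//; last exact: bigcupT_measurable.
  by rewrite (eq_eseriesr (fun c _ => PA c)) poisson_pmf_sum// subee.
rewrite (ge0_negligible_integral _ _ _ _ PU)//; last 2 first.
- exact/measurableC/bigcupT_measurable.
- by move=> w _; apply: nneseries_ge0 => k _ _; rewrite lee_fin.
rewrite setTD setCK ge0_integral_bigcup//; last 2 first.
- exact: measurable_funTS.
- by move=> w _; apply: nneseries_ge0 => k _ _; rewrite lee_fin.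
rewrite -(poisson_pmf_mean rx0); apply: eq_eseriesr => c _.
rewrite EFinM -PA -integral_cst//; apply: eq_integral => w /[!inE] Aw.
exact: Aw.
Qed.

End poisson_arrivals.

(** * Visiting orders *)

Section weighted_orders.
Context {R : realDomainType} {N : nat}.
Variables m c : 'I_N -> R.
Hypothesis m0 : forall i, 0 < m i.

(** The order-dependent part of the throughput when [m] gives the mean tours and [c] the indices. *)
Definition order_value (s : 'S_N) : R :=
  \sum_(i < N) m i * c i * \sum_(k < N | (k < (s^-1)%g i)%N) m (s k).

Definition nondecreasing_order (s : 'S_N) : Prop :=
  forall k l : 'I_N, (k <= l)%N -> c (s k) <= c (s l).

Lemma nondecreasing_order_exists : exists s, nondecreasing_order s.
Proof.
pose r i j := c i <= c j.
have rt : total r by move=> i j; exact: le_total.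
have /tuple_permP[s Es] : perm_eq (sort r (ord_tuple N)) (ord_tuple N).
  by rewrite perm_sort.
exists s => k l kl.
have nthE (j : 'I_N) : nth k (sort r (ord_tuple N)) j = s j.
  rewrite Es (nth_map j) ?size_enum_ord//.
  by rewrite nth_ord_enum tnth_ord_tuple.
have rtr : transitive r by move=> y x z; exact: le_trans.
have /(sorted_leq_nth rtr _ k) : sorted r (sort r (ord_tuple N)).
  exact: sort_sorted.
have rr : reflexive r by move=> i; exact: lexx.
move=> /(_ rr k l); rewrite !inE size_sort size_tuple !ltn_ord.
by move=> /(_ isT isT kl); rewrite !nthE.
Qed.

(** The index that the order [s] credits to a pair: that of the queue visited later, with 0 on the
    diagonal. *)
Let later (s : 'S_N) i j : R :=
  if (s^-1%g j < s^-1%g i)%N then c i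
  else if (s^-1%g i < s^-1%g j)%N then c j else 0.

Let best i j : R := if i == j then 0 else Num.max (c i) (c j).

(** Adding to the sum its copy with [i] and [j] exchanged makes it symmetric over all ordered pairs,
    whence the factor 2. *)
Lemma order_valueE s :
  order_value s *+ 2 = \sum_i \sum_j m i * m j * later s i j.
Proof.
have E : order_value s =
    \sum_i \sum_j if (s^-1%g j < s^-1%g i)%N then m i * m j * c i else 0.
  apply: eq_bigr => i _; rewrite (reindex_inj (@perm_inj _ s^-1%g))/=.
  rewrite mulr_sumr [LHS]big_mkcond/=; apply: eq_bigr => j _.
  by case: ifP => // _; rewrite permKV mulrAC.
have := E; rewrite exchange_big/= => E'.
rewrite mulr2n {1}E E' -big_split/=.
apply: eq_bigr => i _; rewrite -big_split/=; apply: eq_bigr => j _.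
rewrite /later; case: ltngtP => _; rewrite ?addr0 ?add0r ?mulr0//.
by rewrite (mulrC (m i)).
Qed.

Lemma later_le_best s i j : later s i j <= best i j.
Proof.
rewrite /later /best; case: eqP => [->|ij]; first by rewrite ltnn.
case: ltngtP => [_|_|/val_inj/perm_inj ji]; rewrite ?le_max ?lexx ?orbT//.
by case: ij.
Qed.

(** Equality at a pair says that the queue visited later has an index at least as large as the
    other. *)
Lemma later_eq_best s :
  (forall i j, later s i j = best i j) <-> nondecreasing_order s.
Proof.
split=> [E k l|sorted_s i j].
  rewrite leq_eqVlt => /predU1P[/val_inj->//|kl].
  have := E (s k) (s l); rewrite /later /best !permK ltnNge ltnW//= kl.
  by rewrite (inj_eq perm_inj) -val_eqE ltn_eqF// => ->; rewrite le_max lexx.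
rewrite /later /best; case: eqP => [->|ij]; first by rewrite ltnn.
case: ltngtP => [ji|ji|/val_inj/perm_inj ji].
- by have := sorted_s _ _ (ltnW ji); rewrite !permKV => /max_l.
- by have := sorted_s _ _ (ltnW ji); rewrite !permKV => /max_r.
- by case: ij.
Qed.

(** The comparison is termwise; as the weights are positive, the sums agree exactly when every pair
    attains its bound. *)
Lemma order_value_le s :
  order_value s *+ 2 <= \sum_i \sum_j m i * m j * best i j
    ?= iff `[< nondecreasing_order s >].
Proof.
rewrite order_valueE.
have -> : `[< nondecreasing_order s >] =
    [forall i, forall j, later s i j == best i j].
  apply/asboolP/forallP => [/later_eq_best E i|E].
    by apply/forallP => j; rewrite E.
  by apply/later_eq_best => i j; apply/eqP; move: j; apply/forallP.
apply: leif_sum => i _; apply: leif_sum => j _.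
split; first by rewrite ler_pM2l ?mulr_gt0// later_le_best.
by apply: (inj_eq (mulfI _)); rewrite gt_eqF ?mulr_gt0.
Qed.

(** The upper bound does not depend on [s] and a sorted order attains it, so the maximisers are
    exactly the orders attaining it. *)
Lemma order_value_max s :
  (forall s', order_value s' <= order_value s) <-> nondecreasing_order s.
Proof.
split=> [smax|/asboolP ss s']; last first.
  rewrite -(ler_pMn2r (ltn0Sn 1)) (le_trans (order_value_le s'))//.
  by rewrite le_eqVlt eq_sym (order_value_le s) ss.
have [s0 /asboolP s0s] := nondecreasing_order_exists.
apply/asboolP; rewrite -(ge_leif (order_value_le s)).
have /eqP <- : _ == _ := etrans (order_value_le s0).2 s0s.
by rewrite ler_pMn2r.
Qed.

End weighted_orders.

(** * Inputs of one queue *)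

Section sigma_of.
Context {R : realType} {d : measure_display} {Omega : measurableType d}.
Variable X : nat -> Omega -> R.

Lemma sigma_of_measurable :
  (forall k, measurable_fun setT (X k)) -> sigma_of X `<=` measurable.
Proof.
move=> mX; apply: sigma_algebra_sub_measurable => _ [k _ [A mA <-]].
exact: mX.
Qed.

Lemma sigma_ofI : setI_closed (sigma_of X).
Proof.
move=> A B; exact: (@measurableI _ (g_sigma_algebraType
  (\bigcup_k preimage_set_system setT (X k) measurable))).
Qed.

Lemma sigma_ofT : sigma_of X setT.
Proof.
exact: (@measurableT _ (g_sigma_algebraType
  (\bigcup_k preimage_set_system setT (X k) measurable))).
Qed.

Lemma sub_sigma_of k :
  preimage_set_system setT (X k) measurable `<=` sigma_of X.
Proof. by move=> A XA; apply: sub_sigma_algebra; exists k. Qed.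

End sigma_of.

Section finite_independence.
Context {R : realType} {d : measure_display} {Omega : measurableType d}.
Variable P : probability Omega R.

Lemma mutually_independent_fin (I : Type) (F : I -> set (set Omega))
    (K : finType) (j : K -> I) (A : K -> set Omega) :
  mutually_independent P F -> injective j -> (forall x, F (j x) (A x)) ->
  P (\bigcap_x A x) = (\prod_x P (A x))%E.
Proof.
move=> Find jinj FA.
have := Find #|K| (j \o enum_val) (A \o enum_val).
rewrite (_ : \bigcap_l _ = \bigcap_x A x); last first.
  apply/seteqP; split => w /= Aw x _; last exact: Aw.
  by rewrite -(enum_rankK x); exact: Aw.
move=> ->; last 2 first.
- exact: inj_comp jinj enum_val_inj.
- by move=> l; exact: FA.
rewrite (reindex (@enum_val K predT))//=.
by apply: onW_bij; exact: enum_val_bij.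
Qed.

End finite_independence.

Section polling.
Context {R : realType} {d : measure_display} {Omega : measurableType d}.
Context {P : probability Omega R} {N : nat}.
Variable C : polling_cycle P N.

(** Names the family that [inputs_independent] speaks of. *)
Definition input_system (x : input N) : set (set Omega) :=
  match x with
  | VisitTime i => sigma_of (fun=> visit_time C i)
  | OutboundTime i => sigma_of (fun=> outbound_time C i)
  | ReturnTime i => sigma_of (fun=> return_time C i)
  | GenericServiceTime i => sigma_of (fun=> generic_service_time C i)
  | CustomerServiceTime i k => sigma_of (fun=> service_time C i k)
  | ArrivalProcess i => sigma_of (fun k => arrival_time C i k)
  end.

Lemma input_system_measurable x : input_system x `<=` measurable.
Proof. by case: x => *; apply: sigma_of_measurable. Qed.

Lemma input_systemI x : setI_closed (input_system x).
Proof. by case: x => *; exact: sigma_ofI. Qed.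

Lemma input_systemT x : input_system x setT.
Proof. by case: x => *; exact: sigma_ofT. Qed.

Section queue.
Variable i : 'I_N.

(* The inputs on which the completions at queue [i] depend; [service_index]
   stands for the service time of customer [k] or for the generic one, according
   to the option in [queue_input]. *)
Definition queue_index : Type := ('I_N + 'I_N + 'I_N + bool)%type.

Definition visit_index (j : 'I_N) : queue_index := inl (inl (inl j)).
Definition outbound_index (j : 'I_N) : queue_index := inl (inl (inr j)).
Definition return_index (j : 'I_N) : queue_index := inl (inr j).
Definition service_index : queue_index := inr true.
Definition arrival_index : queue_index := inr false.

Definition queue_input (o : option nat) (x : queue_index) : input N :=
  match x with
  | inl (inl (inl j)) => VisitTime j
  | inl (inl (inr j)) => OutboundTime j
  | inl (inr j) => ReturnTime j
  | inr true =>
      if o is Some k then CustomerServiceTime i k else GenericServiceTime i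
  | inr false => ArrivalProcess i
  end.

Lemma queue_input_inj o : injective (queue_input o).
Proof.
by case: o => [k|] [[[j|j]|j]|[]] [[[l|l]|l]|[]]//= [->].
Qed.

Definition queue_service (o : option nat) : {RV P >-> R} :=
  if o is Some k then service_time C i k else generic_service_time C i.

Definition queue_sigma (o : option nat) (D : {set queue_index}) :=
  subfamily (fun x => input_system (queue_input o x)) D.

(** The source of every later independence claim: it suffices to find inputs [D] that determine [X]
    while the remaining ones determine [Y]. *)
Lemma independent_queue_maps o D d1 d2 (T1 : measurableType d1)
    (T2 : measurableType d2) (X : Omega -> T1) (Y : Omega -> T2) :
  measurable_fun [set: g_sigma_algebraType (queue_sigma o D)] X ->
  measurable_fun [set: g_sigma_algebraType (queue_sigma o (~: D))] Y ->
  independent_maps P X Y.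
Proof.
apply: sub_independent_maps; apply: independent_subfamilies.
- by move=> x; exact: input_system_measurable.
- by move=> x; exact: input_systemI.
- by move=> x; exact: input_systemT.
move=> A; apply: mutually_independent_fin; last exact: queue_input_inj.
exact: inputs_independent.
Qed.

Section measurable_inputs.
Variables (o : option nat) (D : {set queue_index}).

Lemma queue_sigma_measurable x (X : Omega -> R) : x \in D ->
  preimage_set_system setT X measurable `<=` input_system (queue_input o x) ->
  measurable_fun [set: g_sigma_algebraType (queue_sigma o D)] X.
Proof. by apply: subfamily_measurable_fun => y; exact: input_systemT. Qed.

Lemma queue_sigma_visit j : visit_index j \in D ->
  measurable_fun [set: g_sigma_algebraType (queue_sigma o D)] (visit_time C j).
Proof.
move=> jD; apply: (queue_sigma_measurable jD).
exact: (@sub_sigma_of _ _ _ _ 0%N).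
Qed.

Lemma queue_sigma_outbound j : outbound_index j \in D ->
  measurable_fun [set: g_sigma_algebraType (queue_sigma o D)]
    (outbound_time C j).
Proof.
move=> jD; apply: (queue_sigma_measurable jD).
exact: (@sub_sigma_of _ _ _ _ 0%N).
Qed.

Lemma queue_sigma_return j : return_index j \in D ->
  measurable_fun [set: g_sigma_algebraType (queue_sigma o D)]
    (return_time C j).
Proof.
move=> jD; apply: (queue_sigma_measurable jD).
exact: (@sub_sigma_of _ _ _ _ 0%N).
Qed.

Lemma queue_sigma_service : service_index \in D ->
  measurable_fun [set: g_sigma_algebraType (queue_sigma o D)]
    (queue_service o).
Proof.
move=> iD; apply: (queue_sigma_measurable iD); rewrite /queue_service /=.
by case: o => [k|]; exact: (@sub_sigma_of _ _ _ _ 0%N).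
Qed.

Lemma queue_sigma_arrival k : arrival_index \in D ->
  measurable_fun [set: g_sigma_algebraType (queue_sigma o D)]
    (arrival_time C i k).
Proof.
by move=> iD; apply: (queue_sigma_measurable iD); exact: sub_sigma_of.
Qed.

(** Visit times enter the start only through queues visited before [i], never through [i] itself;
    this makes the start independent of the visit length. *)
Lemma queue_sigma_start s :
  (forall j, outbound_index j \in D) -> (forall j, return_index j \in D) ->
  (forall j, j != i -> visit_index j \in D) ->
  measurable_fun [set: g_sigma_algebraType (queue_sigma o D)]
    (visit_start C s i).
Proof.
move=> DE DR DV.
rewrite /visit_start; under eq_fun do rewrite big_mkcond/=.
apply: measurable_funD; last exact: queue_sigma_outbound.
apply: measurable_sum => k; case: (boolP (k < (s^-1)%g i)%N) => ki;
  last exact: measurable_cst.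
apply: measurable_funD; last exact: queue_sigma_return.
apply: measurable_funD; first exact: queue_sigma_outbound.
apply: queue_sigma_visit; apply: DV; apply/eqP => ski.
by move: ki; rewrite -ski permK ltnn.
Qed.

End measurable_inputs.
End queue.
End polling.

(** * Completions at one queue *)

Section expectations.
Context {R : realType} {d : measure_display} {Omega : measurableType d}.
Context {P : probability Omega R} {N : nat}.
Variable C : polling_cycle P N.
Variables (s : 'S_N) (i : 'I_N).

Local Notation S := (visit_start C s i).
Local Notation V := (visit_time C i).
Local Notation B := (generic_service_time C i).
Local Notation T := (arrival_time C i).

Lemma visit_start_ge0 w : 0 <= S w.
Proof.
rewrite addr_ge0 ?outbound_time_ge0// sumr_ge0// => k _.
by rewrite !addr_ge0 ?outbound_time_ge0 ?return_time_ge0// ltW ?visit_time_gt0.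
Qed.

Lemma measurable_visit_start : measurable_fun setT S.
Proof.
rewrite /visit_start; apply: measurable_funD => //.
under eq_fun do rewrite big_mkcond/=.
apply: measurable_sum => k; case: (k < (s^-1)%g i)%N => //.
by apply: measurable_funD => //; exact: measurable_funD.
Qed.

(** Either service time is independent of the start and the visit length. With these two frozen only
    its law matters, and the law is the same. *)
Lemma integral_service o (f : R * R * R -> \bar R) :
  measurable_fun setT f -> (forall z, 0 <= f z)%E ->
  (\int[P]_w f (S w, V w, queue_service C i o w) =
   \int[P]_w f (S w, V w, B w))%E.
Proof.
move=> mf f0.
have indep q : (\int[P]_w f (S w, V w, queue_service C i q w) =
    \int[P]_w \int[P]_v f (S w, V w, queue_service C i q v))%E.
  apply: (integral_independent (X := fun w => (S w, V w))) => //.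
    by apply: measurable_fun_pair => //; exact: measurable_visit_start.
  apply: (@independent_queue_maps _ _ _ _ _ C i q [set~ service_index]).
    apply: measurable_fun_pair.
      by apply: queue_sigma_start => *; rewrite !inE.
    by apply: queue_sigma_visit; rewrite !inE.
  by apply: queue_sigma_service; rewrite !inE.
rewrite (indep o) (indep None); apply: eq_integral => w _.
have mfw : measurable_fun setT (fun b => f (S w, V w, b)).
  exact: measurableT_comp.
rewrite -(ge0_integral_distribution (P := P) (queue_service C i o)
  (f := fun b => f (S w, V w, b)))//.
rewrite -(ge0_integral_distribution (P := P) (queue_service C i None)
  (f := fun b => f (S w, V w, b)))//.
apply: eq_measure_integral => X mX _.
by case: o => [k|//]; exact: service_time_distributed.
Qed.

Lemma completion_probabilityE :
  P [set w | (B w <= V w)%R] = (completion_probability C i)%:E.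
Proof.
rewrite fineK// fin_num_measure//; apply: measurable_set_bool.
exact: measurable_fun_ler.
Qed.

Lemma completion_probability_ge0 : 0 <= completion_probability C i.
Proof. by rewrite fine_ge0. Qed.

Section completions.
Variable n : 'I_N -> nat.

Lemma measurable_completes k : measurable_fun setT (completes C n s i k).
Proof.
have mS := measurable_visit_start.
apply: measurable_fun_ler; last exact: measurable_funD.
apply: measurable_funD => //; apply: measurable_maxr => //.
by rewrite /arrival_epoch; case: (k < n i)%N.
Qed.

(** The arrival epoch is 0, no later than the start [S], so service begins at [S] and completes
    exactly when it fits into [V]. *)
Lemma integral_initial_completes k : (k < n i)%N ->
  (\int[P]_w ((completes C n s i k w)%:R : R)%:E =
   (completion_probability C i)%:E)%E.
Proof.
move=> kn.
pose f (z : R * R * R) := (((z.2 <= z.1.2)%R%:R : R)%:E).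
have mf : measurable_fun setT f.
  apply: measurable_fun_natr; apply: measurable_fun_ler => //.
  exact: measurableT_comp.
transitivity (\int[P]_w f (S w, V w, queue_service C i (Some k) w))%E.
  apply: eq_integral => w _.
  rewrite /f/= /completes /visit_end /arrival_epoch kn.
  by rewrite max_l ?visit_start_ge0// lerD2l.
rewrite integral_service//; last by move=> z; rewrite lee_fin.
rewrite /f/= integral_natr; first exact: completion_probabilityE.
exact: measurable_fun_ler.
Qed.

Lemma sum_integral_arrival_completes :
  (\sum_(n i <= k <oo) \int[P]_w ((completes C n s i k w)%:R : R)%:E =
   \int[P]_w (arrival_rate C i * (S w + (V w - B w)) * (B w <= V w)%R%:R)%:E)%E.
Proof.
pose f (z : (R * R * R) * R) :=
  (((Num.max z.1.1.1 z.2 + z.1.2 <= z.1.1.1 + z.1.1.2)%R%:R : R)%:E).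
have mf : measurable_fun setT f.
  apply: measurable_fun_natr; apply: measurable_fun_ler.
    apply: measurable_funD; last exact: measurableT_comp.
    apply: measurable_maxr => //.
    by do 2 apply: measurableT_comp => //.
  by apply: measurable_funD; do 2 apply: measurableT_comp => //.
(* The probability that arrival [k] completes when start, visit length and service time take the
   values [z]. *)
pose h k z := (\int[P]_v f (z, T k v))%E.
have h0 k z : (0 <= h k z)%E by apply: integral_ge0 => v _; rewrite lee_fin.
have mh k : measurable_fun setT (h k).
  apply: (@measurable_fun_fubini_tonelli_F _ _ _ _ _ P
    (fun zv => f (zv.1, T k zv.2))).
    apply: measurableT_comp => //; apply: measurable_fun_pair => //.
    exact: measurableT_comp.
  by move=> zv; rewrite lee_fin.
rewrite -nneseries_addn; last first.
  by move=> k; apply: integral_ge0 => w _; rewrite lee_fin.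
(* Replacing each customer's service time by the common [B] lets one triple serve all [k], so that
   the sum over arrivals can enter the integral. *)
transitivity (\sum_(0 <= k <oo) \int[P]_w h k (S w, V w, B w))%E.
  apply: eq_eseriesr => k _; rewrite -(integral_service (Some (k + n i)%N))//.
  pose U w := (S w, V w, service_time C i (k + n i)%N w).
  transitivity (\int[P]_w f (U w, T k w))%E.
    apply: eq_integral => w _; rewrite /f /completes /arrival_epoch/=.
    by rewrite ltnNge leq_addl/= addnK.
  apply: integral_independent => //; last by move=> z; rewrite lee_fin.
    apply: measurable_fun_pair => //; apply: measurable_fun_pair => //.
    exact: measurable_visit_start.
  apply: (@independent_queue_maps _ _ _ _ _ C i (Some (k + n i)%N)
    [set~ arrival_index]).
    apply: measurable_fun_pair; last first.
      by apply: (@queue_sigma_service _ _ _ _ _ C i (Some _)); rewrite !inE.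
    apply: measurable_fun_pair.
      by apply: queue_sigma_start => *; rewrite !inE.
    by apply: queue_sigma_visit; rewrite !inE.
  by apply: queue_sigma_arrival; rewrite !inE.
rewrite -integral_nneseries//; last first.
  move=> k; apply: (measurableT_comp (mh k)); apply: measurable_fun_pair => //.
  by apply: measurable_fun_pair => //; exact: measurable_visit_start.
apply: eq_integral => w _.
have hE k : h k (S w, V w, B w) =
    P [set v | Num.max (S w) (T k v) + B w <= S w + V w].
  rewrite /h /f/= integral_natr//; apply: measurable_fun_ler => //.
  by apply: measurable_funD => //; exact: measurable_maxr.
under eq_eseriesr do rewrite hE.
(* If [B] exceeds [V], no service begun at or after [S] ends in time; otherwise completing means
   arriving by [S + (V - B)], and the Poisson mean counts these arrivals. *)
have [BV|BV] := leP (B w) (V w); last first.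
  rewrite mulr0; apply: eseries0 => k _ _.
  rewrite (_ : [set _ | _] = set0) ?measure0// -subset0 => v /=.
  by apply/negP; rewrite -ltNge ler_ltD// le_max lexx.
rewrite mulr1.
have SVB : 0 <= S w + (V w - B w).
  by rewrite addr_ge0 ?visit_start_ge0 ?subr_ge0.
rewrite -(poisson_expected_arrivals (arrival_rate_gt0 C i) _
  (arrival_time_poisson C i) SVB)//.
apply: eq_eseriesr => k _; congr (P _); apply/seteqP; split => v /=.
  rewrite -lerBrDr ge_max => /andP[_]; by rewrite -addrA.
by move=> TS; rewrite -lerBrDr ge_max -addrA TS lerDl subr_ge0 BV.
Qed.

End completions.
End expectations.

(** * Throughput *)

Lemma integral_fine_expectation (R : realType) (d : measure_display)
    (Omega : measurableType d) (P : probability Omega R) (X : {RV P >-> R}) :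
  P.-integrable [set: Omega] (EFin \o X) ->
  (\int[P]_w (X w)%:E = (fine 'E_P[X])%:E)%E.
Proof.
by move=> iX; rewrite unlock fineK// integrable_fin_num.
Qed.

(** A zero integral would force [X] to vanish almost everywhere, whereas it vanishes nowhere and the
    space has mass one. *)
Lemma integral_gt0 (R : realType) (d : measure_display)
    (Omega : measurableType d) (P : probability Omega R) (X : Omega -> R) :
  measurable_fun setT X -> (forall w, 0 < X w) -> (0 < \int[P]_w (X w)%:E)%E.
Proof.
move=> mX X0; rewrite lt0e integral_ge0 ?andbT; last first.
  by move=> w _; rewrite lee_fin ltW.
apply/negP => /eqP E.
have mEX : measurable_fun setT (fun w => (X w)%:E) by exact/measurable_EFinP.
have : (\int[P]_w `|(X w)%:E| = 0)%E.
  by rewrite -[RHS]E; apply: eq_integral => w _; rewrite gee0_abs// lee_fin ltW.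
move/(ae_eq_integral_abs P measurableT mEX) => -[A [mA A0 sA]].
have : P A = 1%E.
  rewrite (_ : A = setT) ?probability_setT// -subTset => w _; apply: sA => /=.
  by move=> /(_ I) [] /eqP; rewrite gt_eqF.
by rewrite A0 => /eqP; rewrite eq_sym onee_eq0.
Qed.

Section throughput.
Context {R : realType} {d : measure_display} {Omega : measurableType d}.
Context {P : probability Omega R} {N : nat}.
Variable C : polling_cycle P N.

(** The denominator of [polling_index]. *)
Definition mean_tour (j : 'I_N) : R :=
  fine 'E_P[outbound_time C j] + fine 'E_P[visit_time C j]
  + fine 'E_P[return_time C j].

Lemma mean_tour_gt0 j : 0 < mean_tour j.
Proof.
rewrite /mean_tour -addrA ltr_wpDl ?ltr_pwDl//.
- rewrite fine_ge0// unlock integral_ge0// => w _.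
  by rewrite lee_fin outbound_time_ge0.
- rewrite -lte_fin -integral_fine_expectation;
    last exact: visit_time_integrable.
  by apply: integral_gt0 => // w; exact: visit_time_gt0.
- rewrite fine_ge0// unlock integral_ge0// => w _.
  by rewrite lee_fin return_time_ge0.
Qed.

Lemma integral_visit_start s i :
  (\int[P]_w (visit_start C s i w)%:E =
   (\sum_(k < N | (k < (s^-1)%g i)%N) mean_tour (s k)
    + fine 'E_P[outbound_time C i])%:E)%E.
Proof.
have tour_ge0 j w : (0 <= (outbound_time C j w + visit_time C j w
    + return_time C j w)%:E)%E.
  by rewrite lee_fin !addr_ge0 ?outbound_time_ge0 ?return_time_ge0// ltW
    ?visit_time_gt0.
have mtour j : measurable_fun setT (fun w => (outbound_time C j w
    + visit_time C j w + return_time C j w)%:E).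
  apply/measurable_EFinP; apply: measurable_funD => //.
  exact: measurable_funD.
have Etour j : (\int[P]_w (outbound_time C j w + visit_time C j w
    + return_time C j w)%:E = (mean_tour j)%:E)%E.
  under eq_integral do rewrite !EFinD.
  rewrite ge0_integralD//; last 4 first.
  - move=> w _; rewrite -EFinD lee_fin addr_ge0 ?outbound_time_ge0//.
    by rewrite ltW ?visit_time_gt0.
  - by apply/measurable_EFinP; exact: measurable_funD.
  - by move=> w _; rewrite lee_fin return_time_ge0.
  - exact/measurable_EFinP.
  rewrite ge0_integralD//; last 4 first.
  - by move=> w _; rewrite lee_fin outbound_time_ge0.
  - exact/measurable_EFinP.
  - by move=> w _; rewrite lee_fin ltW ?visit_time_gt0.
  - exact/measurable_EFinP.
  rewrite !integral_fine_expectation//.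
  - exact: return_time_integrable.
  - exact: visit_time_integrable.
  - exact: outbound_time_integrable.
(* The sum over the places before that of [i] is extended by zeros to all places. *)
pose F (k : 'I_N) w : \bar R :=
  if (k < (s^-1)%g i)%N then (outbound_time C (s k) w
    + visit_time C (s k) w + return_time C (s k) w)%:E else 0%E.
have F0 k w : (0 <= F k w)%E by rewrite /F; case: ifP.
have mF k : measurable_fun setT (F k).
  by rewrite /F; case: (k < (s^-1)%g i)%N.
transitivity (\int[P]_w (\sum_(k < N) F k w + (outbound_time C i w)%:E))%E.
  by apply: eq_integral => w _; rewrite -big_mkcond sumEFin.
rewrite ge0_integralD//; last 4 first.
- by move=> w _; exact: sume_ge0.
- exact: emeasurable_sum.
- by move=> w _; rewrite lee_fin outbound_time_ge0.
- exact/measurable_EFinP.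
rewrite integral_fine_expectation; last exact: outbound_time_integrable.
rewrite EFinD -sumEFin ge0_integral_sum//; congr (_ + _)%E.
rewrite [RHS]big_mkcond; apply: eq_bigr => k _; rewrite /F.
by case: (k < (s^-1)%g i)%N; rewrite ?Etour ?integral0.
Qed.

(** The mean of the positive part of V - B, written with an indicator. *)
Definition mean_excess (i : 'I_N) : R := fine (\int[P]_w
  ((visit_time C i w - generic_service_time C i w)
   * (generic_service_time C i w <= visit_time C i w)%R%:R)%:E)%E.

Section queue.
Variables (s : 'S_N) (i : 'I_N).

Local Notation S := (visit_start C s i).
Local Notation V := (visit_time C i).
Local Notation B := (generic_service_time C i).

Let excess_ge0 w : 0 <= (V w - B w) * (B w <= V w)%R%:R.
Proof. by case: (leP (B w) (V w)) => BV; rewrite (mulr1, mulr0) ?subr_ge0. Qed.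

Let measurable_excess :
  measurable_fun setT (fun w => ((V w - B w) * (B w <= V w)%R%:R)%:E).
Proof.
apply/measurable_EFinP/measurable_funM; first exact: measurable_funB.
by apply/measurable_EFinP/measurable_fun_natr; exact: measurable_fun_ler.
Qed.

(** The excess lies between 0 and the integrable [V], so [fine] loses nothing. *)
Lemma integral_excess : (\int[P]_w ((V w - B w) * (B w <= V w)%R%:R)%:E =
  (mean_excess i)%:E)%E.
Proof.
rewrite fineK// ge0_fin_numE; last first.
  by apply: integral_ge0 => w _; rewrite lee_fin.
apply: (@le_lt_trans _ _ (\int[P]_w (V w)%:E)%E); last first.
  by rewrite integral_fine_expectation ?ltry//; exact: visit_time_integrable.
apply: ge0_le_integral => //.
- by move=> w _; rewrite lee_fin.
- exact/measurable_EFinP.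
- move=> w _; rewrite lee_fin.
  case: (leP (B w) (V w)) => BV; rewrite (mulr1, mulr0).
    by rewrite gerBl generic_service_time_ge0.
  by rewrite ltW// visit_time_gt0.
Qed.

Lemma integral_start_completion :
  (\int[P]_w (S w * (B w <= V w)%R%:R)%:E =
   (completion_probability C i)%:E * \int[P]_w (S w)%:E)%E.
Proof.
(* The absolute value makes [f] nonnegative everywhere, as decoupling requires; it changes nothing
   at [S], which is nonnegative. *)
pose f (z : R * (R * R)) := (`|z.1| * (z.2.2 <= z.2.1)%R%:R : R)%:E.
have f0 z : (0 <= f z)%E by rewrite lee_fin mulr_ge0.
have mf : measurable_fun setT f.
  apply/measurable_EFinP/measurable_funM; first exact: measurableT_comp.
  apply/measurable_EFinP/measurable_fun_natr.
  by apply: measurable_fun_ler; exact: measurableT_comp.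
have mS : measurable_fun setT S := measurable_visit_start _ _ _.
transitivity (\int[P]_w f (S w, (V w, B w)))%E.
  by apply: eq_integral => w _; rewrite /f/= ger0_norm// visit_start_ge0.
rewrite (integral_independent (Y := fun w => (V w, B w)) mS)//; last 2 first.
- exact: measurable_fun_pair.
- apply: (@independent_queue_maps _ _ _ _ _ C i None
    (~: [set visit_index i; service_index])).
    apply: queue_sigma_start => [j|j|j ji]; rewrite !inE//.
    rewrite orbF; apply: contra ji => /eqP[->]//.
  rewrite finset.setCK; apply: measurable_fun_pair.
    by apply: queue_sigma_visit; rewrite !inE eqxx.
  by apply: (@queue_sigma_service _ _ _ _ _ C i None); rewrite !inE.
rewrite -ge0_integralZl_EFin//; last 3 first.
- by move=> w _; rewrite lee_fin visit_start_ge0.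
- exact/measurable_EFinP.
- exact: completion_probability_ge0.
apply: eq_integral => w _; rewrite /f/= ger0_norm ?visit_start_ge0//.
under eq_integral do rewrite EFinM.
have mBV : measurable_fun setT (fun v => B v <= V v).
  exact: measurable_fun_ler.
rewrite ge0_integralZl_EFin//; last 2 first.
- exact: (measurable_fun_natr mBV).
- exact: visit_start_ge0.
rewrite (integral_natr mBV) muleC; congr (_ * _)%E.
exact: completion_probabilityE.
Qed.

(** The sum splits at [n i]: initial customers contribute the completion probability each, and later
    ones a part linear in the start plus the excess. *)
Lemma integral_completions (n : 'I_N -> nat) :
  (\sum_(0 <= k <oo) \int[P]_w ((completes C n s i k w)%:R : R)%:E =
   ((n i)%:R * completion_probability C i
    + arrival_rate C i * (completion_probability C i *
        (\sum_(k < N | (k < (s^-1)%g i)%N) mean_tour (s k)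
         + fine 'E_P[outbound_time C i]) + mean_excess i))%:E)%E.
Proof.
rewrite (@nneseries_split _ _ 0 (n i)); last first.
  by move=> k _; apply: integral_ge0 => w _; rewrite lee_fin.
rewrite add0n sum_integral_arrival_completes EFinD; congr (_ + _)%E.
  rewrite big_mkord (eq_bigr (fun=> (completion_probability C i)%:E));
    last first.
    by move=> k _; exact: integral_initial_completes.
  by rewrite sumEFin sumr_const card_ord mulr_natl.
under eq_integral do rewrite -mulrA mulrDl EFinM EFinD.
have mS : measurable_fun setT S := measurable_visit_start _ _ _.
have mSBV : measurable_fun setT (fun w => (S w * (B w <= V w)%R%:R)%:E).
  apply/measurable_EFinP/measurable_funM => //.
  by apply/measurable_EFinP/measurable_fun_natr; exact: measurable_fun_ler.
have SBV0 w : (0 <= (S w * (B w <= V w)%R%:R)%:E)%E.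
  by rewrite lee_fin mulr_ge0// visit_start_ge0.
rewrite ge0_integralZl_EFin//; last 3 first.
- by move=> w _; rewrite adde_ge0// lee_fin.
- exact: emeasurable_funD.
- exact/ltW/arrival_rate_gt0.
rewrite ge0_integralD//; last by move=> w _; rewrite lee_fin.
rewrite integral_start_completion integral_visit_start integral_excess.
by rewrite -!EFinM.
Qed.

End queue.

(** The dependence of the throughput on the initial state is confined to this term. *)
Definition order_free_throughput (n : 'I_N -> nat) : R :=
  \sum_i ((n i)%:R * completion_probability C i
    + arrival_rate C i * (completion_probability C i *
        fine 'E_P[outbound_time C i] + mean_excess i)).

Lemma throughputE n s :
  throughput C n s =
  (order_free_throughput n + order_value mean_tour (polling_index C) s)%:E.
Proof.
rewrite /throughput /completions.
have mc i k :
    measurable_fun setT (fun w => ((completes C n s i k w)%:R : R)%:E).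
  by apply: measurable_fun_natr; exact: measurable_completes.
rewrite ge0_integral_sum//; last 2 first.
- by move=> i; apply: ge0_emeasurable_sum => // k w _ _; rewrite lee_fin.
- by move=> i w _; apply: nneseries_ge0 => k _ _; rewrite lee_fin.
rewrite /order_free_throughput /order_value -big_split/= -sumEFin.
apply: eq_bigr => i _; rewrite integral_nneseries//.
rewrite integral_completions; congr EFin.
(* Cancelling the positive denominator of the index turns the coefficient of the preceding tours
   into the weight used in [order_value]. *)
have -> : mean_tour i * polling_index C i =
    arrival_rate C i * completion_probability C i.
  by rewrite mulrC divfK// gt_eqF// mean_tour_gt0.
by set m := \sum_(k < N | _) _; ring.
Qed.

(** The order-free term cancels when two orders are compared at the same [n], so one criterion
    serves all initial states. *)
Lemma optimal_orderE n s :
  optimal_order C n s <-> nondecreasing_order (polling_index C) s.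
Proof.
rewrite -(order_value_max _ mean_tour_gt0).
by split=> opt s'; have := opt s'; rewrite ?throughputE lee_fin lerD2l.
Qed.

End throughput.

Theorem theorem2 (R : realType) (d : measure_display) (Omega : measurableType d)
    (P : probability Omega R) (N : nat) (hN : (2 <= N)%N)
    (C : polling_cycle P N) :
  (exists s : 'S_N, forall n : 'I_N -> nat, optimal_order C n s) /\
  (forall (n : 'I_N -> nat) (s : 'S_N),
     optimal_order C n s <->
     (forall k l : 'I_N, (k <= l)%N ->
        polling_index C (s k) <= polling_index C (s l))).
Proof.
split; last by move=> n s; exact: optimal_orderE.
have [s sorted_s] := nondecreasing_order_exists (polling_index C).
by exists s => n; apply/optimal_orderE.
Qed.
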